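(* There exists an almost disjoint family $\mathcal{F}$ of true cardinality $\mathfrak{c}$ that is quasi-normal but not almost-normal; that is, the space $\Psi(\mathcal{F})$ is quasi-normal and is not almost-normal.
   Context: An almost disjoint family is an infinite family $\mathcal{A}$ of infinite subsets of $\omega$ such that $a\cap b$ is finite for all distinct $a,b\in\mathcal{A}$ (all almost disjoint families are assumed infinite). For $B\subseteq\omega$ let $\mathcal{A}\upharpoonright_B=\{a\in\mathcal{A}: |a\cap B|=\omega\}$. $\mathcal{A}$ is of true cardinality $\mathfrak{c}$ if for every $B\subseteq\omega$, $\mathcal{A}\upharpoonright_B$ is either finite or of size $\mathfrak{c}=2^{\aleph_0}$. The Mrówka–Isbell space $\Psi(\mathcal{A})$ has underlying set $\omega\cup\mathcal{A}$ (disjoint union); each $\{n\}$ with $n\in\omega$ is open, and the basic open neighbourhoods of a point $a\in\mathcal{A}$ are the sets $\{a\}\cup(a\setminus F)$ with $F\subset\omega$ finite. In a topological space $X$, a set $A$ is regular closed if $A=\overline{\operatorname{int}(A)}$, and $\pi$-closed if it is the intersection of finitely many regular closed sets. Two sets $A,B\subseteq X$ are separated if there are disjoint open sets $U\supseteq A$ and $V\supseteq B$. A regular space is quasi-normal if any two disjoint $\pi$-closed sets are separated; it is almost-normal if any two disjoint sets, one closed and the other regular closed, are separated. An almost disjoint family $\mathcal{A}$ is said to have one of these properties if $\Psi(\mathcal{A})$ has it. *)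

(* Defs.v *)
From HB Require Import structures.
From mathcomp Require Import all_boot.
From mathcomp Require Import all_classical topology.

Set Implicit Arguments.
Unset Strict Implicit.
Unset Printing Implicit Defensive.

Local Open Scope classical_set_scope.
Local Open Scope card_scope.

Definition almost_disjoint_family (A : set (set nat)) : Prop :=
  [/\ infinite_set A,
      forall a, A a -> infinite_set a &
      forall a b, A a -> A b -> a <> b -> finite_set (a `&` b)].

Definition ad_restrict (A : set (set nat)) (B : set nat) : set (set nat) :=
  [set a | A a /\ a `&` B #= [set: nat]].

(* The cardinal of the continuum is represented by the power set of nat. *)
Definition true_cardinality_c (A : set (set nat)) : Prop :=
  forall B : set nat,
    finite_set (ad_restrict A B) \/ ad_restrict A B #= [set: set nat].

Definition Psi (A : set (set nat)) : Type := (nat + A)%type.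

Section PsiTopology.
Variable A : set (set nat).

Definition Psi_nat (n : nat) : Psi A := inl n.
Definition Psi_pt (a : A) : Psi A := inr a.

Definition Psi_basic (a : A) (F : set nat) : set (Psi A) :=
  [set Psi_pt a] `|` (Psi_nat @` (val a `\` F)).

Definition Psi_base : set (set (Psi A)) :=
  [set U | (exists n, U = [set Psi_nat n]) \/
           (exists a F, finite_set F /\ U = Psi_basic a F)].

Lemma Psi_base_cover : \bigcup_(U in Psi_base) id U = setT.
Proof.
apply/seteqP; split=> // -[n|a] _.
- by exists [set Psi_nat n] => //; left; exists n.
- exists (Psi_basic a set0); last by left.
  by right; exists a, set0; split => //; exact: finite_set0.
Qed.

Lemma Psi_base_join (U V : set (Psi A)) (x : Psi A) :
  Psi_base U -> Psi_base V -> id U x -> id V x ->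
  exists W, [/\ Psi_base W, id W x & id W `<=` id U `&` id V].
Proof.
case: x => [n|c] BU BV Ux Vx.
  exists [set Psi_nat n]; split=> //; first by left; exists n.
  by move=> _ ->; split.
case: BU Ux => [[n ->]//|[a [F [finF ->]]]] [[?]|[? _ //]]; subst c.
case: BV Vx => [[n ->]//|[b [G [finG ->]]]] [[?]|[? _ //]]; subst b.
exists (Psi_basic a (F `|` G)); split; last 1 first.
- move=> _ [->|[n [an /not_orP[nF nG]] <-]]; first by split; left.
  by split; right; exists n.
- by right; exists a, (F `|` G); split=> //; rewrite finite_setU.
- by left.
Qed.

HB.instance Definition _ := gen_eqMixin (Psi A).
HB.instance Definition _ := gen_choiceMixin (Psi A).
HB.instance Definition _ :=
  isBaseTopological.Build (Psi A) Psi_base_cover Psi_base_join.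

End PsiTopology.

Definition pi_closed (T : topologicalType) (C : set T) : Prop :=
  exists R : set (set T),
    [/\ finite_set R, R `<=` @regclosed T & C = \bigcap_(D in R) D].

(* Not the library's [separated], which only asks each set to miss the
   closure of the other. *)
Definition open_separated (T : topologicalType) (C D : set T) : Prop :=
  exists U V : set T,
    [/\ open U, open V, C `<=` U, D `<=` V & U `&` V = set0].

Definition quasi_normal (T : topologicalType) : Prop :=
  regular_space T /\
  forall C D : set T, pi_closed C -> pi_closed D -> C `&` D = set0 ->
    open_separated C D.

Definition almost_normal (T : topologicalType) : Prop :=
  regular_space T /\
  forall C D : set T, closed C -> regclosed D -> C `&` D = set0 ->
    open_separated C D.

(* Main.v *)
Require Import Defs.
From HB Require Import structures.
From mathcomp Require Import all_boot.
From mathcomp Require Import all_classical topology.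
From mathcomp Require Import wochoice.

Set Implicit Arguments.
Unset Strict Implicit.
Unset Printing Implicit Defensive.

Local Open Scope classical_set_scope.

(* Call an almost disjoint family B completely separable if every set meeting
   infinitely many members of B contains continuum many of them.  Given such a
   B, let the members of F be finite unions of members of B, chosen injectively
   so that for any finitely many sets X_i, each meeting infinitely many members
   of B, continuum many members of F meet every X_i and lie in their union.
   One set gives true cardinality c.  Applied to the regular closed sets
   defining two pi-closed sets C and D, it gives a common point of C and D
   unless one of them contains only finitely many points of F, and then a clopen
   set separates them.  Finally split omega into X and its complement, both
   meeting infinitely many members of B: the points of F almost disjoint from X
   cannot be separated from the closure of X, since any W meant to separate them
   has either a member of F inside the complement of both X and W, or one meeting
   both X and W \ X.

   For B, consider ideals K orthogonal to a sequence of sets, and say that X is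
   positive for K if X is not the union of a set in K and a set orthogonal to K.
   Slicing K along an unbounded well-ordered chain of its members yields pairwise
   orthogonal smaller ideals of the same kind, the children of K: a positive set
   is positive for two children, and a set with infinite subsets in infinitely
   many children is positive for one of them.  Close under children and countable
   intersections to get a tree, and label each node K with a set in K orthogonal
   to all the children of K.  A set meeting infinitely many labels is positive
   somewhere, hence positive along a perfect set of branches, and there are only
   continuum many such perfect sets, so the labels can be chosen in advance to
   put one inside each positive set. *)

(** * Well-orders and selections *)

Lemma exists_strict_well_order (T : Type) : exists R : T -> T -> Prop,
  [/\ well_founded R, forall x y z, R x y -> R y z -> R x z &
      forall x y, x <> y -> R x y \/ R y x].
Proof.
have [R Rwo] := well_ordering_principle {classic T}.
have Ranti : antisymmetric R.
  by move=> x y; apply: (wo_chain_antisymmetric (withinW Rwo)).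
have Rtot : total R by move=> x y; apply: (wo_chainW (withinW Rwo)).
pose lt (x y : T) := R x y /\ x <> y.
have wf : well_founded lt.
  move=> x; apply: contrapT => nAx.
  have [|z [[/asboolP nAz zmin] _]] := Rwo [pred z | `[< ~ Acc lt z >]].
    by exists x; apply/asboolP.
  apply: nAz; constructor=> y [Ryz nyz]; apply: contrapT => nAy.
  by apply: nyz; apply: Ranti; rewrite Ryz zmin//; apply/asboolP.
have lt_tot x y : x <> y -> lt x y \/ lt y x.
  move=> nxy; have /orP[Rxy|Ryx] := Rtot x y; [left|right]; split=> //.
  exact/nesym.
exists lt; split=> // x y z [Rxy nxy] [Ryz nyz].
have [xz|/lt_tot[//|[Rzx _]]] := pselect (x = z).
  by case: nxy; apply: Ranti; rewrite Rxy xz Ryz.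
have ch : forall s : seq {classic T}, s != [::] -> exists2 a, a \in s &
    forall b, b \in s -> R a b.
  case=> // a0 s _; have [|a [[am amin] _]] := Rwo [pred x | x \in a0 :: s].
    by exists a0; exact: mem_head.
  by exists a => // b bs; apply: amin.
(* Transitivity is read off from a least element of the three points: [y] and [z] are excluded by
   antisymmetry. *)
have [//|a] := ch [:: (x : {classic T}); y; z].
rewrite !inE => /or3P[] /eqP-> H.
- have xz' : x <> z.
    by move=> xz; apply: nxy; apply: Ranti; rewrite Rxy xz Ryz.
  by split=> //; apply: H; rewrite !inE eqxx !orbT.
- by case: nxy; apply: Ranti; rewrite Rxy H// !inE eqxx.
- by case: nyz; apply: Ranti; rewrite Ryz H// !inE eqxx orbT.
Qed.

Lemma wf_minimal (T : Type) (R : T -> T -> Prop) (P : T -> Prop) :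
  well_founded R -> (exists x, P x) ->
  exists2 x, P x & forall y, R y x -> ~ P y.
Proof.
move=> wfR [x]; elim/(well_founded_ind wfR): x => x IH Px.
have [[y Ryx Py]|H] := pselect (exists2 y, R y x & P y); first exact: IH Py.
by exists x => // y Ryx Py; apply: H; exists y.
Qed.

(* The well-order is first cut down so that every index has fewer than
   continuum many predecessors: the values [e p r] can then not all be used
   before stage [p]. *)
Lemma injective_selection (P T : Type) (c : P -> set nat)
    (e : P -> set nat -> T) :
  injective c -> (forall p, injective (e p)) ->
  exists2 f : P -> T, injective f & forall p, exists r, f p = e p r.
Proof.
move=> cinj einj.
have [R [wfR Rtr Rtot]] := exists_strict_well_order (set nat).
pose big x := exists2 g : set nat -> set nat, injective g &
  forall s, R (g s) x.
(* If some element has continuum many predecessors, take the least one, [x0]: the predecessors of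
   [x0] are not [big], and [set nat] embeds among them. Otherwise the identity serves. *)
have [i iinj ismall] : exists2 i : set nat -> set nat, injective i &
    forall s, ~ big (i s).
  have [ebig|nbig] := pselect (exists x, big x); last first.
    by exists id => // s bs; apply: nbig; exists s.
  have [x0 [g ginj gx0] x0min] := wf_minimal wfR ebig.
  by exists g => // s; apply: x0min.
pose k p := i (c p); pose Q p q := R (k p) (k q).
have kinj : injective k by move=> p q /iinj/cinj.
have wfQ : well_founded Q.
  move=> p; have [x] := ex_intro (fun x => k p = x) _ erefl.
  elim/(well_founded_ind wfR): x p => x IH p kp.
  by constructor=> q Qqp; apply: (IH (k q)); rewrite // -kp.
pose F p (rec : forall q, Q q p -> T) : T :=
  match pselect (exists r, forall q (h : Q q p), e p r <> rec q h) with
  | left ex => e p (projT1 (cid ex)) | right _ => e p set0 end.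
pose f := Fix wfQ (fun _ => T) F.
have fE p : f p = F p (fun q _ => f q).
  rewrite /f Fix_eq// => x g h gh; congr F.
  by apply: functional_extensionality_dep => y;
    apply: functional_extensionality_dep => z.
have fex p : exists r, forall q (h : Q q p), e p r <> f q.
  apply: contrapT => /forallNP H.
  have {}H r : exists q, Q q p /\ e p r = f q.
    apply: contrapT => /forallNP H'; apply: (H r) => q Qqp er.
    by apply: (H' q).
  have [q qP] := choice H.
  apply: (ismall (c p)); exists (k \o q) => [r r'|r]; last by case: (qP r).
  by move=> /kinj qq; apply: (einj p); rewrite (qP r).2 (qP r').2 qq.
have fr p : (exists r, f p = e p r) /\ forall q, Q q p -> f p <> f q.
  rewrite {1 2}fE /F; case: pselect => [ex|]; last by case/(_ (fex p)).
  by case: cid => r rP /=; split; [exists r|exact: rP].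
exists f => [p q fpq|p]; last by case: (fr p).
apply: contrapT => npq.
have [|/(fr q).2|/(fr p).2] := Rtot (k p) (k q); first by move=> /kinj.
- by case.
- by case.
Qed.

Definition monotone (f : nat -> nat) := {homo f : m n / (m <= n)%N}.

Definition eventually_le (f g : nat -> nat) :=
  exists m, forall n, (m <= n)%N -> (f n <= g n)%N.

Lemma exists_monotone_gt (h : nat -> nat) :
  exists2 f, monotone f & forall n, (h n < f n)%N.
Proof.
exists (fun n => \sum_(i < n.+1) (h i).+1) => [m n mn|n]; last first.
  by rewrite big_ord_recr /= leq_addl.
rewrite -!(big_mkord xpredT (fun i => (h i).+1)).
by rewrite [leqRHS](big_cat_nat (n := m.+1)) //= leq_addr.
Qed.

(* Greedily keep, along a well-order of all functions, the monotone functions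
   that lie above everything kept so far. *)
Lemma exists_unbounded_chain : exists (R : (nat -> nat) -> (nat -> nat) -> Prop)
    (G : set (nat -> nat)),
  [/\ [/\ well_founded R, forall x y z, R x y -> R y z -> R x z &
      forall x y, x <> y -> R x y \/ R y x],
    forall f, G f -> monotone f,
    forall f g, G f -> G g -> R g f -> eventually_le g f &
    forall h, exists2 f, G f & ~ eventually_le f h].
Proof.
have [R [wfR Rtr Rtot]] := exists_strict_well_order (nat -> nat).
pose F f (rec : forall g, R g f -> Prop) : Prop :=
  monotone f /\ forall g (h : R g f), rec g h -> eventually_le g f.
pose G := Fix wfR (fun _ => Prop) F.
have GE f : G f = F f (fun g _ => G g).
  rewrite /G Fix_eq// => x g h gh; congr F.
  by apply: functional_extensionality_dep => y;
    apply: functional_extensionality_dep => z.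
exists R, G; split=> // [f|f g|h].
- by rewrite GE => -[].
- by rewrite [G f]GE => -[_ H] Gg Rgf; apply: H.
- apply: contrapT => /forall2NP H.
  have {}H g : G g -> eventually_le g h.
    by move=> Gg; case: (H g) => // /contrapT.
  (* If [h] eventually dominated every kept function, a monotone [h'] above [h] would be kept too,
     hence eventually lie below [h]. *)
  have [h' mh' hh'] := exists_monotone_gt h.
  have Gh' : G h'.
    rewrite GE; split=> // g _ /H[m mP]; exists m => n /mP gh.
    exact: leq_trans gh (ltnW (hh' n)).
  by have [m /(_ m (leqnn m))] := H _ Gh'; rewrite leqNgt hh'.
Qed.

(** * Ideals orthogonal to a sequence of sets *)

Lemma finite_subU (T : Type) (A B D : set T) :
  finite_set A -> finite_set B -> D `<=` A `|` B -> finite_set D.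
Proof. by move=> fA fB /sub_finite_set; apply; rewrite finite_setU. Qed.

Lemma finite_natP (S : set nat) :
  finite_set S <-> exists n, forall x, S x -> (x <= n)%N.
Proof.
split=> [/finite_seqP[s ->]|[n Sn]].
  exists (\max_(i <- s) i) => x /= xs.
  by rewrite (big_rem x xs) /= leq_maxl.
by apply: (sub_finite_set _ (finite_II n.+1)) => x /Sn.
Qed.

(** A finite [S] would be covered by finitely many of the [A j], and no point of it could escape all
    of these. *)
Lemma infinite_escaping (A : nat -> set nat) (S : set nat) :
  (forall x, S x -> exists j, A j x) ->
  (forall m, exists2 x, S x & forall i, (i < m)%N -> ~ A i x) ->
  infinite_set S.
Proof.
move=> SA esc /finite_natP[n Sn].
have H x : exists j, S x -> A j x.
  have [/SA[j Ajx]|nSx] := pselect (S x); first by exists j.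
  by exists 0.
have [j jP] := choice H.
have [x Sx] := esc (\max_(i < n.+1) j i).+1; apply; last exact: jP Sx.
by rewrite ltnS (leq_bigmax (Ordinal (Sn _ Sx : x < n.+1)%N)).
Qed.

Lemma iterated_choice (T : Type) (P : T -> Prop) (Q : T -> T -> Prop) x0 :
  P x0 -> (forall x, P x -> exists2 y, P y & Q x y) ->
  exists2 s : nat -> T, s 0 = x0 & forall n, P (s n) /\ Q (s n) (s n.+1).
Proof.
move=> Px0 step.
have H x : exists y, P x -> P y /\ Q x y.
  have [/step[y Py Qxy]|nPx] := pselect (P x); first by exists y.
  by exists x.
have [F FP] := choice H.
have Ps n : P (iter n F x0) by elim: n => //= n /FP[].
by exists (fun n => iter n F x0) => // n; split=> //; case: (FP _ (Ps n)).
Qed.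

(** The sequence runs through elements with only finitely many predecessors in [S]; the least
    element of [S] above such a point is again of this kind. *)
Lemma increasing_sequence (T : Type) (R : T -> T -> Prop) (S : set T) :
  well_founded R -> (forall x y, x <> y -> R x y \/ R y x) ->
  infinite_set S ->
  exists s : nat -> T, forall n, S (s n) /\ R (s n) (s n.+1).
Proof.
move=> wfR Rtot infS.
pose P x := S x /\ finite_set [set y | S y /\ R y x].
have [x0 Sx0 x0min] := wf_minimal wfR (infinite_setN0 infS).
have Px0 : P x0.
  by split=> //; apply: (sub_finite_set _ (@finite_set0 T)) => y [Sy /x0min].
have [x [Sx finx]|s _ sP] := iterated_choice Px0 (Q := R); last first.
  by exists s => n; have [[]] := sP n.
have finx' : finite_set ([set y | S y /\ R y x] `|` [set x]).
  by rewrite finite_setU; split=> //; exact: finite_set1.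
have above y : S y -> ~ R x y -> ([set y | S y /\ R y x] `|` [set x]) y.
  move=> Sy nRxy; have [->|nyx] := pselect (y = x); first by right.
  by left; split=> //; have [//|] := Rtot _ _ nyx.
have [|y [Sy Rxy] ymin] := wf_minimal (P := fun y => S y /\ R x y) wfR.
  apply: contrapT => /forallNP H; apply: infS.
  by apply: sub_finite_set finx' => y Sy; apply: above => // Rxy; apply: (H y).
exists y => //; split=> //; apply: sub_finite_set finx' => z [Sz Rzy].
by apply: above => // Rxz; apply: (ymin z).
Qed.

Definition perp (A : nat -> set nat) : set (set nat) :=
  [set D | forall m, finite_set (D `&` A m)].

Definition countably_perp (K : set (set nat)) := exists A, K = perp A.

Definition orthogonal (K L : set (set nat)) :=
  forall D E, K D -> L E -> finite_set (D `&` E).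

(* [X] is not the union of a member of [K] and a set orthogonal to [K]. *)
Definition positive (K : set (set nat)) (X : set nat) :=
  forall P, K P -> exists D, [/\ K D, infinite_set D & D `<=` X `\` P].

Lemma orthogonal_sym K L : orthogonal K L -> orthogonal L K.
Proof. by move=> KL D E LD KE; rewrite setIC; apply: KL. Qed.

Lemma orthogonalS K K' L L' :
  K' `<=` K -> L' `<=` L -> orthogonal K L -> orthogonal K' L'.
Proof. by move=> sK sL KL D E /sK KD /sL; apply: KL. Qed.

Lemma perpS A D E : E `<=` D -> perp A D -> perp A E.
Proof. by move=> ED PD m; apply: sub_finite_set (PD m); apply: setSI. Qed.

Lemma perpU A D E : perp A D -> perp A E -> perp A (D `|` E).
Proof. by move=> PD PE m; rewrite setIUl finite_setU. Qed.

Lemma perp0 A : perp A set0.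
Proof. by move=> m; rewrite set0I; exact: finite_set0. Qed.

(** If the condition fails at [m], the part of [X] outside the first [m] sets lies in the ideal, and
    what remains of [X] contains no infinite member of it. Conversely, choosing for each [m] a point
    of [X] outside [P] that escapes the first [m] sets gives an infinite member of the ideal. *)
Lemma positiveP A X : positive (perp A) X <->
  forall m, exists k, infinite_set (X `&` A k `\` \bigcup_(i < m) A i).
Proof.
split=> [pos m|H P PP].
  apply: contrapT => /forallNP H.
  have PP : perp A (X `\` \bigcup_(i < m) A i).
    move=> k; have /contrapT := H k; apply: sub_finite_set.
    by move=> x [[Xx nx] Ax].
  have [D [PD infD DX]] := pos _ PP; apply: infD.
  have : finite_set (\bigcup_(i < m) (D `&` A i)).
    by apply: bigcup_finite => // i _; exact: PD.
  apply: sub_finite_set => x Dx; have [Xx nx] := DX _ Dx.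
  by apply: contrapT => H'; apply: nx; split=> // -[i im Aix]; apply: H'; exists i.
have {}H m : exists x, [/\ X x, ~ P x, exists k, A k x &
    forall i, (i < m)%N -> ~ A i x].
  have [k infk] := H m.
  have /infinite_setN0[x [[[Xx Ax] nx] nPx]] :
      infinite_set ((X `&` A k `\` \bigcup_(i < m) A i) `\` P).
    move=> fin; apply: infk; apply: (finite_subU fin (PP k)) => x [[Xx Ax] nx].
    by have [Px|nPx] := pselect (P x); [right|left].
  by exists x; split=> // [|i im Aix]; [exists k|apply: nx; exists i].
have [d dP] := choice H.
exists (range d); split=> [m||_ [m _ <-]].
- apply: (sub_finite_set _ (finite_image d (finite_II m.+1))).
  move=> _ [[n _ <-] Amdn]; exists n => //=; rewrite ltnS leqNgt.
  by apply/negP => mn; case: (dP n) => _ _ _ /(_ m mn).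
- apply: (@infinite_escaping A) => [_ [m _ <-]|m]; first by case: (dP m).
  by exists (d m); [exists m|case: (dP m)].
- by case: (dP m).
Qed.

Lemma positiveD A X P :
  perp A P -> positive (perp A) X -> positive (perp A) (X `\` P).
Proof.
move=> KP pos P' KP'; have [D [KD infD DX]] := pos _ (perpU KP KP').
by exists D; split=> // x /DX[Xx /not_orP[]].
Qed.

(** * Children of an ideal *)

(** Here [b] is to be the label of [K]. The third clause makes perfect trees grow below a positive
    set; the fourth bounds the number of children met by a set that is positive nowhere. *)
Definition child_system (K : set (set nat)) (b : set nat)
    (Ch : set (set (set nat))) :=
  [/\ forall L, Ch L -> [/\ countably_perp L, L `<=` K &
        forall D, L D -> finite_set (D `&` b)],
    forall L L', Ch L -> Ch L' -> L <> L' -> orthogonal L L',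
    forall X, positive K X -> exists L L',
      [/\ Ch L, Ch L', L <> L', positive L X & positive L' X] &
    forall X, infinite_set [set L | Ch L /\
        exists D, [/\ L D, infinite_set D & D `<=` X]] ->
      exists2 L, Ch L & positive L X].

(* The children of [K] are the layers of an unbounded well-ordered chain of
   members of [K], at the limits of increasing sequences of the chain. *)
Lemma exists_child_system K b :
  countably_perp K -> K b -> exists Ch, child_system K b Ch.
Proof.
move=> [A ->{K}] Kb.
have [R [G [[wfR Rtr Rtot] Gmono Gle Gunb]]] := exists_unbounded_chain.
pose col m := A m `\` \bigcup_(i < m) A i.
(* Including [b] in every [below f] makes the later layers orthogonal to [b]. *)
pose below (f : nat -> nat) := b `|` [set x | exists2 m, col m x & (x <= f m)%N].
pose strip f := [set D : set nat | finite_set (D `\` below f) /\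
  forall g, G g -> R g f -> finite_set (D `&` below g)].
(* At the supremum of a sequence [s] of the chain, being almost disjoint from all earlier [below g]
   reduces to the countably many [below (s n)], so the layer is again orthogonal to a sequence. *)
pose limit s f := [/\ G f, forall n : nat, G (s n) /\ R (s n) (s n.+1),
  forall n, R (s n) f &
  forall g, G g -> R g f -> exists n, g = s n \/ R g (s n)].
have below_le g f : G g -> eventually_le g f -> finite_set (below g `\` below f).
  move=> Gg [m0 gf]; apply/finite_natP; exists (g m0) => x [[bx|[m cx xg]] nx].
    by case: nx; left.
  have [mm0|m0m] := leqP m m0; first exact: leq_trans xg (Gmono _ Gg _ _ mm0).
  by case: nx; right; exists m => //; apply: leq_trans xg (gf _ (ltnW m0m)).
have below_lt g f : G g -> G f -> R g f -> finite_set (below g `\` below f).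
  by move=> Gg Gf Rgf; apply: below_le => //; exact: Gle.
have Kbelow f : G f -> perp A (below f).
  move=> Gf; apply: perpU => // k; apply/finite_natP; exists (f k).
  move=> x [[m [_ nx] xf] Akx]; apply: leq_trans xf (Gmono _ Gf _ _ _).
  by rewrite leqNgt; apply/negP => km; apply: nx; exists k.
have belowI D g f : G g -> G f -> g = f \/ R g f ->
    finite_set (D `&` below f) -> finite_set (D `&` below g).
  move=> Gg Gf [-> //|Rgf] fin.
  apply: (finite_subU fin (below_lt _ _ Gg Gf Rgf)) => x [Dx gx].
  by have [fx|nfx] := pselect (below f x); [left|right].
have limit_perp s f : limit s f -> strip f =
    perp (fun n => if n is n'.+1 then below (s n') else ~` below f).
  move=> [Gf sP sf cof]; apply/seteqP; split=> D.
    by move=> [fin H] [|n]; [rewrite -setDE|apply: H; case: (sP n)].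
  move=> H; split=> [|g Gg /(cof _ Gg)[n gn]]; first by have := H 0; rewrite -setDE.
  by apply: belowI gn (H n.+1) => //; case: (sP n).
have Rirr f : ~ R f f.
  by elim/(well_founded_ind wfR): f => f IH Rff; exact: (IH f).
have sup s : (forall n, G (s n) /\ R (s n) (s n.+1)) -> exists f, limit s f.
  move=> sP.
  have [|f [Gf sf] fmin] := wf_minimal (P := fun f => G f /\ forall n, R (s n) f) wfR.
    (* The diagonal maximum eventually dominates each [s n], so a chain function that it does not
       dominate comes after all of them. *)
    have [f Gf nf] := Gunb (fun n => \max_(i < n.+1) s i n).
    exists f; split=> // n; apply: contrapT => nR; apply: nf.
    have [m fm] : eventually_le f (s n).
      have [->|/Rtot[Rf|//]] := pselect (f = s n); first by exists 0.
      by apply: Gle => //; case: (sP n).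
    exists (maxn m n) => k; rewrite geq_max => /andP[mk nk].
    apply: leq_trans (fm _ mk) _.
    exact: (leq_bigmax (F := fun i : 'I_k.+1 => s i k) (Ordinal (nk : n < k.+1)%N)).
  exists f; split=> // g Gg /fmin H.
  have /existsNP[n nR] : ~ forall n, R (s n) g by move=> sg; apply: H.
  exists n; have [->|/Rtot[|//]] := pselect (g = s n); first by left.
  by right.
have limit_pos s f X : limit s f ->
    (forall n, exists D, [/\ infinite_set D, D `<=` X,
      finite_set (D `\` below (s n)) &
      forall k, (k < n)%N -> finite_set (D `&` below (s k))]) ->
    positive (strip f) X.
  move=> sf H; rewrite (limit_perp _ _ sf); case: sf => [Gf sP Rsf _].
  (* Index 0 of the family describing [strip f] is the complement of [below f], so [below (s m)] has
     index [m.+1]. *)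
  apply/positiveP => m; exists m.+1; have [D [infD DX finD Dk]] := H m => fin.
  apply: infD; apply: (finite_subU fin (B := (D `\` below (s m)) `|`
      \bigcup_(i < m) (D `&` below (s i)) `|` (D `\` below f))); last first.
    move=> x Dx; have Xx := DX _ Dx.
    have [Bx|] := pselect (below (s m) x); last by right; left; left.
    have [[i im six]|nx] := pselect (exists2 i, (i < m)%N & below (s i) x).
      by right; left; right; exists i.
    have [fx|nfx] := pselect (below f x); last by right; right.
    left; split=> // -[[|i] /= im] //; move=> six; apply: nx; exists i => //.
    exact: ltn_trans im.
  rewrite !finite_setU; split; first split=> //.
    by apply: bigcup_finite => // i; exact: Dk.
  apply: (finite_subU finD (below_lt _ _ (sP m).1 Gf (Rsf m))) => x [Dx nfx].
  by have [sx|nsx] := pselect (below (s m) x); [right|left].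
have pos_hits X : positive (perp A) X -> exists2 f, G f & infinite_set (X `&` below f).
  move=> /positiveP posX.
  have H m : exists xj : nat * nat, [/\ X xj.1, col xj.2 xj.1 & (m <= xj.2)%N].
    have [k /infinite_setN0[x [[Xx Ax] nx]]] := posX m.
    have ex : exists k, `[< A k x >] by exists k; apply/asboolP.
    case: (ex_minnP ex) => j /asboolP Aj jmin; exists (x, j); split=> //=.
      split=> // -[i /= ij Aix]; have /jmin : `[< A i x >] by exact/asboolP.
      by rewrite leqNgt ij.
    by rewrite leqNgt; apply/negP => jm; apply: nx; exists j.
  have [xj xjP] := choice H.
  (* This [f] exceeds the chosen point for infinitely many [m]. That point lies in a column of index
     at least [m], so by monotonicity it falls under [f]. *)
  have [f Gf nf] := Gunb (fun m => (xj m).1); exists f => // fin.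
  have : infinite_set (range (fst \o xj) `&` below f).
    apply: (@infinite_escaping A) => [_ [[m _ <-] _]|m].
      by exists (xj m).2; have [_ []] := xjP m.
    have [n mn fn] : exists2 n, (m <= n)%N & ((xj n).1 < f n)%N.
      apply: contrapT => /forall2NP H'; apply: nf; exists m => n mn.
      by case: (H' n) => [/(_ mn)//|/negP]; rewrite -leqNgt.
    have [Xn [An nA] nj] := xjP n.
    exists (xj n).1.
      split; first by exists n.
      right; exists (xj n).2 => //.
      exact: leq_trans (ltnW fn) (Gmono _ Gf _ _ nj).
    by move=> i im Ai; apply: nA; exists i => //=; apply: leq_trans im (leq_trans mn nj).
  apply; apply: sub_finite_set fin => _ [[m _ <-] ?]; split=> //.
  by have [] := xjP m.
have pos_step X f0 : positive (perp A) X -> G f0 -> exists f, [/\ G f, R f0 f &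
    exists D, [/\ infinite_set D, D `<=` X & strip f D]].
  move=> posX Gf0; have posX' := positiveD (Kbelow _ Gf0) posX.
  (* The first [f] catching infinitely many points of [X] outside [below f0] catches them in its own
     layer, by minimality. *)
  have [|f [Gf inff] fmin] := wf_minimal
    (P := fun f => G f /\ infinite_set ((X `\` below f0) `&` below f)) wfR.
    by have [f] := pos_hits _ posX'; exists f.
  exists f; split=> //.
    have [ff0|/Rtot[Rff0|//]] := pselect (f = f0).
      case: inff; rewrite ff0 setDE -setIA setICl setI0; exact: finite_set0.
    case: inff; apply: sub_finite_set (below_lt _ _ Gf Gf0 Rff0).
    by move=> x [[_ nx] ?].
  exists ((X `\` below f0) `&` below f); split=> // [x [[]]//|].
  split=> [|g Gg Rgf].
    by apply: (sub_finite_set _ (@finite_set0 nat)) => x [[_ ?]].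
  apply: contrapT => H; apply: (fmin g Rgf); split=> //; apply: contra_not H.
  by apply: sub_finite_set => x [[? _] ?].
have strip_seq_pos s X : (forall n, G (s n) /\ R (s n) (s n.+1)) ->
    (forall n, exists D, [/\ infinite_set D, D `<=` X & strip (s n) D]) ->
    forall f, limit s f -> positive (strip f) X.
  move=> sP H f sf; apply: (limit_pos _ _ _ sf) => n.
  have [D [infD DX [Dn Dlt]]] := H n; exists D; split=> // k kn.
  apply: Dlt; first by case: (sP k).
  elim: n kn {H D infD DX Dn} => // n IH.
  rewrite ltnS leq_eqVlt => /orP[/eqP->|/IH]; first by case: (sP n).
  by move=> Rkn; apply: Rtr Rkn (sP n).2.
have pos_above X f0 : positive (perp A) X -> G f0 -> exists s f,
    [/\ limit s f, R f0 f & positive (strip f) X].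
  move=> posX Gf0.
  pose P f := [/\ G f, R f0 f & exists D, [/\ infinite_set D, D `<=` X & strip f D]].
  have [f1 Pf1] : exists f, P f by exact: pos_step.
  have [|s _ sP] := iterated_choice Pf1 (Q := R).
    move=> f [Gf Rf0f _]; have [g [Gg Rfg gP]] := pos_step _ _ posX Gf.
    by exists g => //; split=> //; apply: Rtr Rfg.
  have sP' n : G (s n) /\ R (s n) (s n.+1) by have [[]] := sP n.
  have [f sf] := sup _ sP'; exists s, f; split=> //.
    by have [_ _ /(_ 0) R0f _] := sf; apply: Rtr R0f; have [[]] := sP 0.
  by apply: strip_seq_pos sf => // n; have [[]] := sP n.
have strip_orth f f' : G f -> R f f' -> orthogonal (strip f) (strip f').
  move=> Gf Rff' D E [finD _] [_ /(_ _ Gf Rff') finE].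
  apply: (finite_subU finD finE) => x [Dx Ex].
  by have [fx|nfx] := pselect (below f x); [right|left].
exists [set L | exists s f, limit s f /\ L = strip f]; split.
- move=> L [s [f [sf ->]]]; split.
  + by eexists; exact: limit_perp sf.
  + move=> D [finD _] m; have [Gf _ _ _] := sf.
    apply: (finite_subU finD (Kbelow _ Gf m)) => x [Dx Ax].
    by have [fx|nfx] := pselect (below f x); [right|left].
  + move=> D [_ /(_ (s 0))]; have [_ /(_ 0)[G0 _] /(_ 0) R0 _] := sf.
    move=> /(_ G0 R0); apply: sub_finite_set => x [Dx bx].
    by split=> //; left.
- move=> _ _ [s [f [sf ->]]] [s' [f' [sf' ->]]] ff'.
  have Gf : G f by case: sf.
  have Gf' : G f' by case: sf'.
  have [/strip_orth|/strip_orth] := Rtot f f' (fun e => ff' (congr1 strip e)).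
    exact.
  by move=> /(_ Gf') /orthogonal_sym.
- move=> X posX; have [f0 Gf0 _] := Gunb (fun=> 0).
  have [s [f [sf _ pf]]] := pos_above _ _ posX Gf0.
  have Gf : G f by case: sf.
  have [s' [f' [sf' Rff' pf']]] := pos_above _ _ posX Gf.
  exists (strip f), (strip f'); split=> //; [by exists s, f|by exists s', f'|].
  move=> ff'; have [|D [_ infD _]] := pf set0.
    by rewrite (limit_perp _ _ sf); exact: perp0.
  have [|D' [SD' infD' _]] := pf set0.
    by rewrite (limit_perp _ _ sf); exact: perp0.
  apply: infD'; rewrite -[D']setIid.
  by apply: (strip_orth _ _ Gf Rff') => //; rewrite -ff'.
- move=> X inf.
  pose Phi := [set f | (exists s, limit s f) /\
    exists D, [/\ strip f D, infinite_set D & D `<=` X]].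
  have infPhi : infinite_set Phi.
    move=> fin; apply: inf; apply: sub_finite_set (finite_image strip fin).
    by move=> _ [[s [f [sf ->]]] ?]; exists f => //; split=> //; exists s.
  have [s sP] := increasing_sequence wfR Rtot infPhi.
  have sP' n : G (s n) /\ R (s n) (s n.+1).
    by have [[[? []]]] := sP n.
  have [f sf] := sup _ sP'.
  exists (strip f); first by exists s, f.
  by apply: strip_seq_pos sf => // n; have [[_ [D []]]] := sP n; exists D.
Qed.

(** * Labelled trees of ideals *)

Lemma exists_injection_sequences :
  exists c : (nat -> set nat) -> set nat, injective c.
Proof.
exists (fun p => [set k | exists i m : nat, k = pickle (i, m) /\ p i m]).
have sub (p q : nat -> set nat) i m : p i m ->
    (exists i' m' : nat, pickle (i, m) = pickle (i', m') /\ p i' m') =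
    (exists i' m' : nat, pickle (i, m) = pickle (i', m') /\ q i' m') -> q i m.
  move=> pim e; have : exists i' m' : nat, pickle (i, m) = pickle (i', m') /\ q i' m'.
    by rewrite -e; exists i, m.
  by move=> [i' [m' [/(pcan_inj pickleK)[-> ->]]]].
move=> p q /= pq; have pqE k := congr1 (@^~ k) pq.
apply: functional_extensionality_dep => i; apply/seteqP; split=> m pm.
  exact: (sub p) (pqE (pickle (i, m))).
exact: (sub q) (esym (pqE (pickle (i, m)))).
Qed.


Definition initial_word (z : set nat) (n : nat) : seq bool :=
  [seq `[< z i >] | i <- iota 0 n].

Lemma initial_wordS z n : initial_word z n.+1 = rcons (initial_word z n) `[< z n >].
Proof. by rewrite /initial_word -addn1 iotaD map_cat /= cats1. Qed.

Lemma countably_perpS K D E : countably_perp K -> E `<=` D -> K D -> K E.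
Proof. by move=> [A ->]; exact: perpS. Qed.

Definition join_families (A : nat -> nat -> set nat) (k : nat) : set nat :=
  if unpickle k is Some nm then A nm.1 nm.2 else set0.

Lemma bigcap_perp A : \bigcap_n perp (A n) = perp (join_families A).
Proof.
apply/seteqP; split=> D.
  move=> H k; rewrite /join_families; case: unpickle => [[n m]|]; first exact: H.
  by rewrite setI0; exact: finite_set0.
by move=> H n _ m; have := H (pickle (n, m)); rewrite /join_families pickleK.
Qed.

Lemma countably_perp_seq (T : Type) (Ks : T -> set (set nat)) :
  (forall n, countably_perp (Ks n)) ->
  exists A : T -> nat -> set nat, Ks = fun n => perp (A n).
Proof.
move=> /choice[A AP]; exists A.
by apply: functional_extensionality_dep => n; exact: AP.
Qed.

Lemma countably_perp_bigcap (Ks : nat -> set (set nat)) :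
  (forall n, countably_perp (Ks n)) -> countably_perp (\bigcap_n Ks n).
Proof.
by move=> /countably_perp_seq[A ->]; exists (join_families A); exact: bigcap_perp.
Qed.

(** The first [m] sets of the joined family involve only finitely many of the ideals. A [D] in those
    ideals but not in the intersection has an infinite trace on some further set and is almost
    disjoint from the first [m]. *)
Lemma positive_bigcap (Ks : nat -> set (set nat)) X :
  (forall n, countably_perp (Ks n)) ->
  (forall N, exists D, [/\ D `<=` X, forall n, (n <= N)%N -> Ks n D &
    ~ (\bigcap_n Ks n) D]) ->
  positive (\bigcap_n Ks n) X.
Proof.
move=> /countably_perp_seq[A ->] H; rewrite bigcap_perp; apply/positiveP => m.
pose idx (k : nat) := if @unpickle (nat * nat)%type k is Some nm then nm.1 else 0.
have [D [DX DN]] := H (\max_(j < m) idx j).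
move=> /existsNP[n /not_implyP[_ /existsNP[k infD]]].
exists (pickle (n, k)); rewrite {1}/join_families pickleK => fin; apply: infD.
have finD : finite_set (\bigcup_(j < m) (D `&` join_families A j)).
  apply: bigcup_finite => // j /= jm.
  have := leq_bigmax (F := fun i : 'I_m => idx i) (Ordinal jm).
  rewrite /join_families /= {1}/idx; case: unpickle => [[n' k']|] /=.
    by move/DN; apply.
  by rewrite setI0 => _; exact: finite_set0.
apply: (finite_subU fin finD) => x [Dx Ax].
have [[j jm jx]|nx] := pselect ((\bigcup_(j < m) join_families A j) x).
  by right; exists j.
by left; split=> //; split=> //; exact: DX.
Qed.

(* A sequence [p] codes a set [p 0], a parameter [p 1] and a binary tree of
   countable families; [branch p z] belongs to the branch [z] of that tree. *)
Definition branch (p : nat -> set nat) (z : set nat) : set (set nat) :=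
  \bigcap_n perp (fun m => p (pickle (initial_word z n, m)).+2).

Definition perfect (p : nat -> set nat) :=
  (forall z z', z <> z' -> orthogonal (branch p z) (branch p z')) /\
  forall z, positive (branch p z) (p 0).

Lemma countably_perp_branch p z : countably_perp (branch p z).
Proof. by apply: countably_perp_bigcap => n; eexists. Qed.

Lemma countably_perp0 K : countably_perp K -> K set0.
Proof. by move=> [A ->]; exact: perp0. Qed.

Lemma positive_infinite K X : countably_perp K -> positive K X ->
  exists D, [/\ K D, infinite_set D & D `<=` X].
Proof.
by move=> /countably_perp0 K0 /(_ _ K0)[D [KD iD DX]]; exists D; rewrite setD0 in DX.
Qed.

(* The labels are fixed before the tree that they will be used to grow:
   there are only continuum many perfect codes. *)
Lemma exists_labelling : exists (label : set (set nat) -> set nat)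
    (f : (nat -> set nat) -> set (set nat)),
  [/\ forall K, countably_perp K -> K (label K),
    forall p, perfect p -> [/\ exists z, f p = branch p z,
      infinite_set (label (f p)) & label (f p) `<=` p 0] &
    forall p q, perfect p -> perfect q -> f p = f q -> p = q].
Proof.
have [code codeI] := exists_injection_sequences.
have infb p z : perfect p ->
    exists D, [/\ branch p z D, infinite_set D & D `<=` p 0].
  by move=> [_ /(_ z)]; apply: positive_infinite; exact: countably_perp_branch.
have [||f finj fP] := injective_selection (P := {p | perfect p})
  (c := fun p => code (sval p)) (e := fun p => branch (sval p)).
- by move=> [p pP] [q qP] /= /codeI pq; apply: eq_exist.
(* Orthogonal ideals that coincide have no infinite member, whereas each branch of a perfect code
   has one inside [p 0]. *)
- move=> [p pP] z z' /= zz'; apply: contrapT => /(pP.1 _ _) oz.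
  have [D [zD infD _]] := infb p z pP; apply: infD.
  by rewrite -[D]setIid; apply: oz => //; rewrite -zz'.
have infP (p : {p | perfect p}) :
    exists D, [/\ f p D, infinite_set D & D `<=` sval p 0].
  by have [z ->] := fP p; apply: infb; case: p.
pose lab p := projT1 (cid (infP p)).
have labP p : [/\ f p (lab p), infinite_set (lab p) & lab p `<=` sval p 0].
  exact: projT2 (cid (infP p)).
pose label K := match pselect (exists p, f p = K) with
  | left ex => lab (projT1 (cid ex)) | right _ => set0 end.
have labelE p : label (f p) = lab p.
  rewrite /label; case: pselect => [ex|]; last by case; exists p.
  by case: cid => q /= /finj->.
pose f' p := match pselect (perfect p) with
  | left pP => f (exist perfect p pP) | right _ => set0 end.
have f'E p (pP : perfect p) : f' p = f (exist perfect p pP).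
  by rewrite /f'; case: pselect => // pP'; rewrite (Prop_irrelevance pP' pP).
exists label, f'; split=> [K cK|p pP|p q pP qP].
- rewrite /label; case: pselect => [ex|_]; last exact: countably_perp0.
  by case: cid => p /= <-; case: (labP p).
- rewrite (f'E p pP) labelE; have [? ? ?] := labP (exist perfect p pP); split=> //.
- by rewrite (f'E p pP) (f'E q qP) => /finj[].
Qed.

(** * Comparison of nodes and almost disjointness of labels *)

Inductive node (Ch : set (set nat) -> set (set (set nat))) (K0 : set (set nat)) :
    set (set nat) -> Prop :=
| node_root : node Ch K0 K0
| node_child K L : node Ch K0 K -> Ch K L -> node Ch K0 L
| node_bigcap (Ks : nat -> set (set nat)) :
    (forall n, node Ch K0 (Ks n)) -> node Ch K0 (\bigcap_n Ks n).

Definition labelled_tree label Ch := forall K, countably_perp K ->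
  K (label K) /\ child_system K (label K) (Ch K).

Lemma node_perp label Ch K0 K : labelled_tree label Ch ->
  countably_perp K0 -> node Ch K0 K -> countably_perp K.
Proof.
move=> tree cK0; elim=> // [{}K L _ cK KL|Ks _ ?].
  by have [_ [/(_ _ KL)[? _ _] _ _ _]] := tree _ cK.
exact: countably_perp_bigcap.
Qed.

Lemma node_sub_root label Ch K0 K : labelled_tree label Ch ->
  countably_perp K0 -> node Ch K0 K -> K `<=` K0.
Proof.
move=> tree cK0; elim=> // [{}K L nK sK KL|Ks _ IH].
  have [_ [/(_ _ KL)[_ sL _] _ _ _]] := tree _ (node_perp tree cK0 nK).
  exact: subset_trans sL sK.
by move=> D /(_ 0 I)/IH.
Qed.

(* The tree analogue of the extreme points in Zermelo's proof of the
   well-ordering theorem. *)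
Definition extreme Ch K0 K := forall L, node Ch K0 L -> K `<=` L ->
  [\/ L `<=` K, exists2 M, Ch L M & K `<=` M | orthogonal K L].

(** Induction on [L]. Extremality of [K] is used when passing from [L] to its child [L1]: a [K]
    inside [L] is either [L] itself, or inside one child of [L], which is [L1] or orthogonal to it,
    or orthogonal to [L]. *)
Lemma extreme_compare label Ch K0 K : labelled_tree label Ch ->
  countably_perp K0 -> node Ch K0 K -> extreme Ch K0 K ->
  forall L, node Ch K0 L ->
  [\/ K `<=` L, orthogonal K L | exists2 M, Ch K M & L `<=` M].
Proof.
move=> tree cK0 nK extK L; elim=> [|{}L L1 nL IH LL1|Ks nKs IH].
- by constructor 1; apply: (node_sub_root tree cK0 nK).
- have [_ [sLCh oLCh _ _]] := tree _ (node_perp tree cK0 nL).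
  have [_ sL1 _] := sLCh _ LL1.
  case: IH => [KL|KL|[M KM LM]].
  + case: (extK _ nL KL) => [LK|[M LM KM]|oKL].
    * have eKL : K = L by apply/seteqP.
      by constructor 3; exists L1; rewrite ?eKL.
    * have [<-|/(oLCh _ _ LM LL1) oM] := pselect (M = L1); first by constructor 1.
      by constructor 2; apply: orthogonalS oM.
    * by constructor 2; apply: orthogonalS oKL.
  + by constructor 2; apply: orthogonalS KL.
  + by constructor 3; exists M => //; apply: subset_trans LM.
- have sub n : \bigcap_n Ks n `<=` Ks n by move=> D /(_ n I).
  have [[n H]|H] := pselect (exists n, ~ K `<=` Ks n).
    case: (IH n) => // [o|[M KM sM]].
      by constructor 2; apply: orthogonalS o.
    by constructor 3; exists M => //; apply: subset_trans sM.
  constructor 1 => D KD n _; apply: contrapT => nD; apply: H; exists n.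
  by apply: contra_not nD; apply.
Qed.

Lemma node_extreme label Ch K0 K : labelled_tree label Ch ->
  countably_perp K0 -> node Ch K0 K -> extreme Ch K0 K.
Proof.
move=> tree cK0; elim=> [L nL _|K' {}K nK' ext' K'K L nL KL|Ks nKs IH L nL KL].
- by constructor 1; apply: (node_sub_root tree cK0 nL).
- have [_ [sCh oCh _ _]] := tree _ (node_perp tree cK0 nK').
  have [_ sK _] := sCh _ K'K.
  case: (extreme_compare tree cK0 nK' ext' nL) => [K'L|o|[M K'M LM]].
  + case: (ext' _ nL K'L) => [LK'|[M LM K'M]|o].
    * have eL : L = K' by apply/seteqP.
      by constructor 2; exists K; rewrite ?eL.
    * by constructor 2; exists M => //; apply: subset_trans K'M.
    * by constructor 3; apply: orthogonalS o.
  + by constructor 3; apply: orthogonalS o.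
  + have [<-|/(oCh _ _ K'M K'K) o] := pselect (M = K); first by constructor 1.
    by constructor 3; apply/orthogonal_sym; apply: orthogonalS o.
- have sub n : \bigcap_n Ks n `<=` Ks n by move=> D /(_ n I).
  have [[n H]|H] := pselect (exists n, ~ L `<=` Ks n); last first.
    constructor 1 => D LD n _; apply: contrapT => nD; apply: H; exists n.
    by apply: contra_not nD; apply.
  case: (extreme_compare tree cK0 (nKs n) (IH n) nL) => [KnL|o|[M KnM LM]].
  + case: (IH n _ nL KnL) => // [[M LM sM]|o].
      by constructor 2; exists M => //; apply: subset_trans sM.
    by constructor 3; apply: orthogonalS o.
  + by constructor 3; apply: orthogonalS o.
  + have [_ [/(_ _ KnM)[_ sM _] _ _ _]] := tree _ (node_perp tree cK0 (nKs n)).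
    by case: H; apply: subset_trans sM.
Qed.

Lemma node_compare label Ch K0 K L : labelled_tree label Ch ->
  countably_perp K0 -> node Ch K0 K -> node Ch K0 L ->
  [\/ K `<=` L, orthogonal K L | exists2 M, Ch K M & L `<=` M].
Proof.
by move=> tree cK0 nK; exact: (extreme_compare tree cK0 nK (node_extreme tree cK0 nK)).
Qed.

Lemma label_dichotomy label Ch K0 K L : labelled_tree label Ch ->
  countably_perp K0 -> node Ch K0 K -> node Ch K0 L ->
  L (label K) \/ forall D, L D -> finite_set (D `&` label K).
Proof.
move=> tree cK0 nK nL.
have [KlK [sCh _ _ _]] := tree _ (node_perp tree cK0 nK).
case: (node_compare tree cK0 nK nL) => [KL|o|[M KM LM]]; first by left; exact: KL.
  by right=> D LD; rewrite setIC; apply: o.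
by right=> D /LM; case: (sCh _ KM) => _ _; apply.
Qed.

(** Since [label L] is infinite and lies in both ideals, [K] and [L] are not orthogonal; nor can [K]
    lie inside a child of [L], whose members are almost disjoint from [label L]. So [L] lies
    strictly below [K]. *)
Lemma label_child label Ch K0 K L : labelled_tree label Ch ->
  countably_perp K0 -> node Ch K0 K -> node Ch K0 L -> L <> K ->
  infinite_set (label L) -> K (label L) ->
  exists2 M, Ch K M & M (label L).
Proof.
move=> tree cK0 nK nL LK inf KL.
have [LlL [sL _ _ _]] := tree _ (node_perp tree cK0 nL).
have orth_abs : ~ orthogonal K L.
  by move=> o; apply: inf; rewrite -[label L]setIid; apply: o.
case: (node_compare tree cK0 nK nL) => // [sKL|[M KM LM]]; last first.
  by exists M => //; exact: LM.
case: (node_extreme tree cK0 nK nL sKL) => // [sLK|[M LM KM]].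
  by case: LK; apply/seteqP.
case: inf; rewrite -[label L]setIid.
by case: (sL _ LM) => _ _; apply; exact: KM.
Qed.

Lemma label_almost_disjoint label Ch K0 K L : labelled_tree label Ch ->
  countably_perp K0 -> node Ch K0 K -> node Ch K0 L -> K <> L ->
  finite_set (label K `&` label L).
Proof.
move=> tree cK0 nK nL KL.
case: (pselect (finite_set (label L))) => [fin|infL]; first exact: finite_setIr.
have [KlK [sK _ _ _]] := tree _ (node_perp tree cK0 nK).
have [|] := label_dichotomy tree cK0 nL nK; last exact.
move=> /(label_child tree cK0 nK nL (nesym KL) infL)[M KM ML].
by rewrite setIC; case: (sK _ KM) => _ _; apply.
Qed.

Lemma ultra_bigcup (I : Type) (T : choiceType) (U : set_system I)
    (S : set T) (F : T -> set I) :
  UltraFilter U -> finite_set S -> U (\bigcup_(t in S) F t) ->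
  exists2 t, S t & U (F t).
Proof.
move=> UU /finite_seqP[s ->] UF; apply: contrapT => /forall2NP H.
have HU : U [set i | forall t, t \in s -> ~ F t i].
  elim: s {UF} H => [_|t s IH H]; first by apply: filterS filterT.
  have Ut : U (~` F t).
    case: (H t) => [|nU]; first by case; rewrite /= mem_head.
    by have [/nU|] := in_ultra_setVsetC (F t) UU.
  have Us : U [set i | forall t, t \in s -> ~ F t i].
    by apply: IH => t'; case: (H t') => [nt'|]; [left|right] => //;
      apply: contra_not nt' => /= t's; rewrite inE t's orbT.
  apply: filterS (filterI Ut Us) => i [nt ns] t'.
  by rewrite inE => /orP[/eqP->|/ns].
by have [i [[t ts Fti] /(_ t ts)]] := filter_ex (filterI UF HU).
Qed.

(** * A completely separable family *)

(* If no node is positive, an ultrafilter on infinitely many hitting labels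
   selects a chain of nodes without a last element, yet every countable
   intersection of selected nodes is again selected. *)
Lemma hits_positive label Ch K0 X : labelled_tree label Ch ->
  countably_perp K0 ->
  infinite_set [set K | node Ch K0 K /\ infinite_set (label K `&` X)] ->
  exists2 K, node Ch K0 K & positive K X.
Proof.
move=> tree cK0 /infiniteP/pcard_leP/injfunPex[Ks KsP Ksinj].
have nKs i : node Ch K0 (Ks i) by case: (KsP i I).
have infKsX i : infinite_set (label (Ks i) `&` X) by case: (KsP i I).
have infKs i : infinite_set (label (Ks i)).
  by apply: contra_not (infKsX i); exact: finite_setIl.
have nperp K : node Ch K0 K -> countably_perp K by exact: node_perp tree cK0.
apply: contrapT => /forall2NP npos.
have {}npos K : node Ch K0 K -> ~ positive K X by case: (npos K).
have [U [UU Uoo]] := ultraFilterLemma (F := \oo) _.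
(* A node is selected when it contains almost all of the labels in the sense of the nonprincipal
   ultrafilter [U]. *)
pose sel K := node Ch K0 K /\ U [set i | K (label (Ks i))].
have lab_sub K i : node Ch K0 K -> K (label (Ks i)) -> K (label (Ks i) `&` X).
  by move=> nK; apply: (countably_perpS (nperp _ nK)); exact: subIsetl.
have sel_root : sel K0.
  split; first exact: node_root.
  apply: filterS filterT => i _ /=; apply: (node_sub_root tree cK0 (nKs i)).
  by case: (tree _ (nperp _ (nKs i))).
have sel_child K : sel K -> exists2 M, Ch K M & sel M.
  move=> [nK UK].
  have [_ [sK _ _ infpos]] := tree _ (nperp _ nK).
  pose S := [set M | Ch K M /\ exists i, M (label (Ks i))].
  have finS : finite_set S.
    apply: contrapT => infS.
    have [|M KM pM] := infpos X.
      apply: sub_infinite_set infS => M [KM [i Mi]]; split=> //.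
      exists (label (Ks i) `&` X); split=> //.
      exact: lab_sub (node_child nK KM) Mi.
    exact: npos (node_child nK KM) pM.
  (* At most one index has [Ks i = K]. Beyond it, each label in [K] lies in a child, and [U] selects
     one of the finitely many children in [S]. *)
  have [N UN] : exists N, U [set i | (N <= i)%N /\ Ks i <> K].
    have [[i0 KsK]|nex] := pselect (exists i, Ks i = K).
      exists i0.+1; apply: Uoo; exists i0.+1 => // i /= ii0; split=> // KsiK.
      have ei : i = i0 by apply: Ksinj; rewrite ?in_setT ?KsK.
      by rewrite ei ltnn in ii0.
    exists 0; apply: Uoo; exists 0 => // i /= _; split=> // Ksi.
    by apply: nex; exists i.
  have [|M [KM _] UM] := ultra_bigcup UU finS (F := fun M => [set i | M (label (Ks i))]).
    apply: filterS (filterI UK UN) => i [Ki [_ KsK]].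
    have [M KM Mi] := label_child tree cK0 nK (nKs i) KsK (infKs i) Ki.
    by exists M => //; split=> //; exists i.
  by exists M => //; split=> //; exact: node_child KM.
have sel_bigcap (KK : nat -> set (set nat)) :
    (forall n, sel (KK n)) -> sel (\bigcap_n KK n).
  move=> sKK; have nKK n := (sKK n).1.
  have nI : node Ch K0 (\bigcap_n KK n) by exact: node_bigcap.
  split=> //.
  (* Otherwise labels lying in the first ideals but not in the whole intersection, cut down to [X],
     make the intersection positive. *)
  have [//|UV] :=
    in_ultra_setVsetC [set i | (\bigcap_n KK n) (label (Ks i))] UU.
  case: (npos _ nI); apply: positive_bigcap => [n|N]; first exact: nperp.
  have UN : U [set i | forall n, (n <= N)%N -> KK n (label (Ks i))].
    elim: N => [|N IH].
      by apply: filterS (sKK 0).2 => i K0i n; rewrite leqn0 => /eqP->.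
    apply: filterS (filterI IH (sKK N.+1).2) => i [IHi KNi] n.
    by rewrite leq_eqVlt => /orP[/eqP->|/IHi].
  have [i [iN iV]] := filter_ex (filterI UN UV).
  exists (label (Ks i) `&` X); split; first exact: subIsetr.
    by move=> n /iN; exact: lab_sub.
  move=> H; apply: iV => n _.
  have [//|orth] := label_dichotomy tree cK0 (nKs i) (nKK n).
  case: (infKsX i); have := orth _ (H n I); apply: sub_finite_set.
  by move=> x [lx Xx]; do !split.
have sel_or L : node Ch K0 L -> sel L \/ exists2 K, sel K & orthogonal L K.
  elim=> [|K {}L nK IH KL|Ls nLs IH]; first by left.
  - have [_ [sK oK _ _]] := tree _ (nperp _ nK).
    case: IH => [/sel_child[M KM sM]|[K' sK' o]].
      have [<-|ML] := pselect (M = L); first by left.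
      by right; exists M => //; apply: oK => //; exact/nesym.
    right; exists K' => //; apply: orthogonalS o => //.
    by case: (sK _ KL).
  - have [H|/existsNP[n nsel]] := pselect (forall n, sel (Ls n)).
      by left; exact: sel_bigcap.
    have [//|[K sK o]] := IH n.
    by right; exists K => //; apply: orthogonalS o => // D /(_ n I).
(* Each label is missed by some selected node; the intersection of these nodes is selected although
   it contains none of the labels. *)
have avoid i : exists K, sel K /\ ~ K (label (Ks i)).
  have [lKs [sKs _ _ _]] := tree _ (nperp _ (nKs i)).
  have abs K : ~ (K (label (Ks i)) /\
      forall D, K D -> finite_set (D `&` label (Ks i))).
    by move=> [/[swap] H /H]; rewrite setIid; exact: infKs.
  case: (sel_or _ (nKs i)) => [/sel_child[M KM sM]|[K sK o]].
    exists M; split=> // Mi; apply: (abs M); split=> //.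
    by case: (sKs _ KM).
  exists K; split=> // Ki; apply: (abs K); split=> // D KD.
  by rewrite setIC; apply: o.
have [KK KKP] := choice avoid.
have [|_ UI] := sel_bigcap KK; first by move=> n; case: (KKP n).
by have [i /(_ i I)] := filter_ex UI; case: (KKP i).
Qed.

Lemma positive_perfect label Ch K0 K X (r : set nat) :
  labelled_tree label Ch -> countably_perp K0 ->
  node Ch K0 K -> positive K X ->
  exists p, [/\ p 0 = X, p 1 = r, perfect p & forall z, node Ch K0 (branch p z)].
Proof.
move=> tree cK0 nK pK.
have nperp L : node Ch K0 L -> countably_perp L by exact: node_perp tree cK0.
have step L : exists F : bool -> set (set nat), node Ch K0 L -> positive L X ->
    [/\ forall b, Ch L (F b) /\ positive (F b) X & orthogonal (F true) (F false)].
  have [[nL pL]|nLp] := pselect (node Ch K0 L /\ positive L X); last first.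
    by exists (fun=> L) => nL pL; case: nLp.
  have [_ [_ oL posL _]] := tree _ (nperp _ nL).
  have [L0 [L1 [LL0 LL1 L01 p0 p1]]] := posL _ pL.
  exists (fun b : bool => if b then L0 else L1) => _ _; split; first by case.
  exact: oL.
have [F FP] := choice step.
pose N (s : seq bool) := foldl F K s.
have NS s b : N (rcons s b) = F (N s) b by rewrite /N -cats1 foldl_cat.
have NP s : node Ch K0 (N s) /\ positive (N s) X.
  elim/last_ind: s => [//|s b [nN pN]]; rewrite NS.
  have [/(_ b)[Cb pb] _] := FP _ nN pN; split=> //; exact: node_child Cb.
have NO s b c : b != c -> orthogonal (N (rcons s b)) (N (rcons s c)).
  rewrite !NS; have [nN pN] := NP s; have [_ o] := FP _ nN pN.
  by case: b c => [] [] // _; apply/orthogonal_sym.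
have Nsub s b : N (rcons s b) `<=` N s.
  have [nN pN] := NP s; have [_ [sN _ _ _]] := tree _ (nperp _ nN).
  by rewrite NS; have [/(_ b)[Cb _] _] := FP _ nN pN; case: (sN _ Cb).
have [A AP] : exists A : seq bool -> nat -> set nat, N = fun s => perp (A s).
  by apply: countably_perp_seq => s; case: (NP s) => /nperp.
pose p k : set nat := match k with 0 => X | 1 => r | k'.+2 =>
  if @unpickle (seq bool * nat)%type k' is Some sm then A sm.1 sm.2 else set0 end.
have pE z : branch p z = \bigcap_n N (initial_word z n).
  rewrite /branch AP; congr (bigcap _ _).
  apply: functional_extensionality_dep => n; congr perp.
  by apply: functional_extensionality_dep => m; rewrite /p pickleK.
exists p; split=> // [|z]; last first.
  by rewrite pE; apply: node_bigcap => n; case: (NP (initial_word z n)).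
split=> [z z' zz'|z]; rewrite !pE.
  have ex : exists n, `[< z n >] != `[< z' n >].
    apply: contrapT => /forallNP H; apply: zz'; apply/seteqP; split=> n.
      by move=> zn; have /negP/negPn/eqP := H n; rewrite asboolT// => /esym/asboolP.
    by move=> zn; have /negP/negPn/eqP := H n; rewrite [RHS]asboolT// => /asboolP.
  case: (ex_minnP ex) => n nz nmin.
  have pfx : initial_word z n = initial_word z' n.
    apply/eq_in_map => i; rewrite mem_iota add0n /= => ilt.
    by apply/eqP; apply: contraTT ilt => /nmin; rewrite -leqNgt.
  apply: (orthogonalS _ _ (NO (initial_word z n) _ _ nz)) => D /(_ n.+1 I).
    by rewrite initial_wordS.
  by rewrite initial_wordS -pfx.
apply: positive_bigcap => [n|m]; first by case: (NP (initial_word z n)) => /nperp.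
(* The witness follows [z] for [m] steps and then turns off: it lies in the ideals up to level [m]
   and, by orthogonality of siblings, not in the next one. *)
have [nN pN] := NP (rcons (initial_word z m) (~~ `[< z m >])).
have [D [ND infD DX]] := positive_infinite (nperp _ nN) pN.
exists D; split=> // [n nm|/(_ m.+1 I)].
  have : N (initial_word z m) D by exact: Nsub ND.
  elim: m nm {nN pN ND} => [|m IH]; first by rewrite leqn0 => /eqP->.
  rewrite leq_eqVlt => /orP[/eqP->//|nm]; rewrite initial_wordS => /Nsub.
  exact: IH.
rewrite initial_wordS => ND'; apply: infD; rewrite -[D]setIid.
by apply: NO ND ND'; case: `[< _ >].
Qed.

Definition column (m : nat) : set nat :=
  [set x | exists k : nat, x = pickle (m, k)].

Lemma positive_columns (S : set nat) :
  (forall m, exists2 k, (m <= k)%N & S k) ->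
  positive (perp column) [set x | exists2 k, S k & column k x].
Proof.
move=> unbS; apply/positiveP => m; have [k mk Sk] := unbS m; exists k => fin.
have : finite_set (range (fun j : nat => pickle (k, j))).
  apply: sub_finite_set fin => _ [j _ <-]; split.
    by split; [exists k => //; exists j|exists j].
  move=> [i /= im [j' /(pcan_inj pickleK)[ki _]]].
  by rewrite -ki ltnNge mk in im.
rewrite (eq_finite_set (inj_card_eq _)); first exact: infinite_nat.
by move=> i j _ _ /(pcan_inj pickleK)[].
Qed.

Definition completely_separable (B : set (set nat)) :=
  [/\ forall b, B b -> infinite_set b,
    forall a b, B a -> B b -> a <> b -> finite_set (a `&` b) &
    forall X, infinite_set [set b | B b /\ infinite_set (b `&` X)] ->
      exists2 g : set nat -> set nat, injective g &
        forall r, B (g r) /\ g r `<=` X].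

Lemma exists_completely_separable : exists2 B, completely_separable B &
  exists X, infinite_set [set b | B b /\ infinite_set (b `&` X)] /\
    infinite_set [set b | B b /\ infinite_set (b `&` ~` X)].
Proof.
have [label [f [labK fP finj]]] := exists_labelling.
have H K : exists Ch, countably_perp K -> child_system K (label K) Ch.
  have [cK|ncK] := pselect (countably_perp K); last by exists set0.
  by have [Ch ChP] := exists_child_system cK (labK _ cK); exists Ch.
have [Ch ChP] := choice H.
have tree : labelled_tree label Ch.
  by move=> K cK; split; [exact: labK|exact: ChP].
pose K0 := perp column.
have cK0 : countably_perp K0 by exists column.
pose B := [set b | exists K, [/\ node Ch K0 K, infinite_set b & b = label K]].
have positive_many K X : node Ch K0 K -> positive K X ->
    exists2 g : set nat -> set nat, injective g & forall r, B (g r) /\ g r `<=` X.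
  move=> nK pK.
  (* Storing [r] in the code as [p 1] gives continuum many perfect codes for the same [X], hence
     distinct nodes and distinct labels. *)
  have [p pP] := choice (fun r => positive_perfect r tree cK0 nK pK).
  have perfp r : perfect (p r) by case: (pP r).
  have nf r : node Ch K0 (f (p r)).
    by have [[z ->] _ _] := fP _ (perfp r); case: (pP r).
  have inff r : infinite_set (label (f (p r))) by case: (fP _ (perfp r)).
  exists (fun r => label (f (p r))) => [r r' rr'|r].
    have [/finj pp|ff'] := pselect (f (p r) = f (p r')).
      by have [_ <- _ _] := pP r; have [_ <- _ _] := pP r'; rewrite pp.
    case: (inff r); rewrite -[label _]setIid {2}rr'.
    exact: (label_almost_disjoint tree cK0).
  split; first by exists (f (p r)).
  by have [_ _] := fP _ (perfp r); have [-> _ _ _] := pP r.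
have many_hits X : (exists2 g : set nat -> set nat, injective g &
      forall r, B (g r) /\ g r `<=` X) ->
    infinite_set [set b | B b /\ infinite_set (b `&` X)].
  move=> [g ginj gP].
  have : infinite_set (range (g \o set1)).
    rewrite (eq_finite_set (inj_card_eq _)); first exact: infinite_nat.
    by move=> i j _ _ /ginj ij; have : [set i] i by []; rewrite ij.
  apply: sub_infinite_set => _ [i _ <-] /=; have [Bg gX] := gP [set i].
  by split=> //; rewrite setIidl//; case: Bg => K [].
exists B.
  split=> [b [K []]//|_ _ [K [nK _ ->]] [L [nL _ ->]] KL|X infX].
    by apply: (label_almost_disjoint tree cK0) => // eKL; apply: KL; rewrite eKL.
  have [|K nK pK] := hits_positive (X := X) tree cK0; last exact: positive_many pK.
  move=> fin; apply: infX; apply: sub_finite_set (finite_image label fin).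
  by move=> _ [[K [nK _ ->]] infK]; exists K.
have unb (b : bool) m : exists2 k, (m <= k)%N & [set k | odd k = b] k.
  exists (m.*2 + b); last by rewrite /= oddD odd_double; case: b.
  by rewrite -addnn -addnA leq_addr.
(* The union of the odd columns is positive for the root, and so is its complement, which contains
   the even columns. *)
exists [set x | exists2 k, [set k | odd k = true] k & column k x]; split.
  apply: many_hits; apply: (positive_many K0); first exact: node_root.
  exact: positive_columns.
apply: many_hits; apply: (positive_many K0); first exact: node_root.
have pos := positive_columns (unb false) => P KP.
have [D [KD infD DX]] := pos P KP; exists D; split=> // x /DX[[k kev [j xj]] nPx].
split=> // -[k' kod [j' xj']]; move: xj'; rewrite xj => /(pcan_inj pickleK)[kk _].
by move: kod; rewrite /= -kk kev.
Qed.

(** * Gluing *)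

Definition hits (F : set (set nat)) (X : set nat) : set (set nat) :=
  [set a | F a /\ infinite_set (a `&` X)].

Definition multiply_full (F : set (set nat)) :=
  forall s : seq (set nat), s != [::] ->
    (forall X, X \in s -> infinite_set (hits F X)) ->
  exists2 g : set nat -> set nat, injective g & forall r,
    [/\ F (g r), forall X, X \in s -> infinite_set (g r `&` X) &
      g r `<=` \bigcup_(X in [set` s]) X].

Lemma exists_multiply_full (B : set (set nat)) X0 : completely_separable B ->
  infinite_set (hits B X0) -> infinite_set (hits B (~` X0)) ->
  exists F, [/\ almost_disjoint_family F, multiply_full F,
    infinite_set (hits F X0) & infinite_set (hits F (~` X0))].
Proof.
move=> [Binf Bad Bfull] hX0 hX0c.
have [c0 c0I] := exists_injection_sequences.
(* A triple holds a list of sets, a parameter that gives continuum many glued sets per list, and a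
   position in the list. *)
pose Q := (seq (set nat) * set nat * nat)%type.
(* The length is recorded because [nth] pads with [set0]. *)
pose c1 (q : Q) n := match n with 0 => q.1.2 | 1 => [set q.2]
  | 2 => [set size q.1.1] | j.+3 => nth set0 q.1.1 j end.
have c1I : injective c1.
  move=> [[s r] i] [[s' r'] i'] e.
  have rr : r = r' := congr1 (@^~ 0) e.
  have ii : [set i'] i by rewrite -(congr1 (@^~ 1) e : [set i] = [set i']).
  have ss : [set size s'] (size s).
    by rewrite -(congr1 (@^~ 2) e : [set size s] = [set size s']).
  congr (_, _, _) => //; apply: (@eq_from_nth _ set0) => // j _.
  exact: (congr1 (@^~ j.+3) e).
pose full (q : Q) := infinite_set (hits B (nth set0 q.1.1 q.2)).
have gex (q : {q | full q}) : exists g : set nat -> set nat,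
    injective g /\ forall r, B (g r) /\ g r `<=` nth set0 (sval q).1.1 (sval q).2.
  by case: q => q /= /Bfull[g]; exists g.
have [g gP] := choice gex.
have [|q|f finj fP] := injective_selection (c := c0 \o c1 \o sval) (e := g).
- by move=> [q qP] [q' qP'] /= /c0I/c1I qq'; apply: eq_exist.
- by case: (gP q).
pose b q := match pselect (full q) with
  left qP => f (exist full q qP) | right _ => set0 end.
have bP q : full q -> B (b q) /\ b q `<=` nth set0 q.1.1 q.2.
  move=> qP; rewrite /b; case: pselect => // qP'.
  by have [r ->] := fP (exist full q qP'); case: (gP (exist full q qP')).
have bI q q' : full q -> full q' -> b q = b q' -> q = q'.
  by move=> qP qP'; rewrite /b; do 2!case: pselect => // ?; move=> /finj[].
pose a (sr : seq (set nat) * set nat) := \bigcup_(i < size sr.1) b (sr, i).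
pose ok (s : seq (set nat)) := s != [::] /\ forall X, X \in s -> infinite_set (hits B X).
have okP s r i : ok s -> (i < size s)%N -> full (s, r, i).
  by move=> [_ H] iS; apply: H; exact: mem_nth.
pose F := [set x | exists s r, ok s /\ x = a (s, r)].
have a_inf s r i : ok s -> (i < size s)%N -> infinite_set (a (s, r) `&` nth set0 s i).
  move=> os iS; have [Bb bs] := bP _ (okP s r i os iS).
  apply: sub_infinite_set (Binf _ Bb) => x bx; split; last exact: bs.
  by exists i.
have F_inf s r : ok s -> infinite_set (a (s, r)).
  move=> os fin; have s0 : (0 < size s)%N by case: s os {fin} => [[]|].
  by apply: (a_inf s r 0 os s0); exact: finite_setIl.
have a_ad s r s' r' : ok s -> ok s' -> (s, r) <> (s', r') ->
    finite_set (a (s, r) `&` a (s', r')).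
  move=> os os' ne.
  rewrite /a setI_bigcupl; apply: bigcup_finite => // i iS.
  rewrite setI_bigcupr; apply: bigcup_finite => // j jS.
  apply: Bad; [by case: (bP _ (okP s r i os iS))|by case: (bP _ (okP s' r' j os' jS))|].
  move=> /(bI _ _ (okP s r i os iS) (okP s' r' j os' jS))[es er _].
  by apply: ne; rewrite es er.
have aI s r r' : ok s -> a (s, r) = a (s, r') -> r = r'.
  move=> os e; apply: contrapT => ne; apply: (F_inf s r os).
  by rewrite -[a _]setIid {2}e; apply: a_ad => // -[].
have hitsFB X : infinite_set (hits F X) -> infinite_set (hits B X).
  (* Each member of [B] used in gluing belongs to one glued set only, by injectivity of [b]. A glued
     set meeting [X] has a component meeting [X], so infinitely many of the former require
     infinitely many of the latter. *)
  have psiP y : exists x, forall s r i, ok s -> (i < size s)%N ->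
      y = b (s, r, i) -> x = a (s, r).
    have [[s [r [i [os [iS ->]]]]]|H] := pselect (exists s r i, ok s /\
        (i < size s)%N /\ y = b (s, r, i)).
      exists (a (s, r)) => s' r' i' os' iS'.
      by move=> /(bI _ _ (okP s r i os iS) (okP s' r' i' os' iS'))[-> ->].
    by exists set0 => s r i os iS e; case: H; exists s, r, i.
  have [psi psiE] := choice psiP.
  apply: contra_not => /(finite_image psi); apply: sub_finite_set.
  move=> _ [[s [r [os ->]]] infX].
  have [i iS iX] : exists2 i, (i < size s)%N & infinite_set (b (s, r, i) `&` X).
    apply: contrapT => /forall2NP H; apply: infX.
    rewrite /a setI_bigcupl; apply: bigcup_finite => // i iS.
    by case: (H i) => [|/contrapT].
  exists (b (s, r, i)); last exact: psiE os iS erefl.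
  by split=> //; case: (bP _ (okP s r i os iS)).
have fullB s : ok s -> exists2 g : set nat -> set nat, injective g & forall r,
    [/\ F (g r), forall X, X \in s -> infinite_set (g r `&` X) &
      g r `<=` \bigcup_(X in [set` s]) X].
  move=> os; exists (fun r => a (s, r)) => [r r'|r]; first exact: aI.
  split=> [|X Xs|x [i /= iS bx]]; first by exists s, r.
    by rewrite -(nth_index set0 Xs); apply: a_inf => //; rewrite index_mem.
  have [_ bs] := bP _ (okP s r i os iS).
  by exists (nth set0 s i); [exact: mem_nth|exact: bs].
have hitsBF X : infinite_set (hits B X) -> infinite_set (hits F X).
  move=> hX; have [|h hI hP] := fullB [:: X].
    by split=> // Y; rewrite inE => /eqP->.
  have : infinite_set (range (h \o set1)).
    rewrite (eq_finite_set (inj_card_eq _)); first exact: infinite_nat.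
    by move=> i j _ _ /hI ij; have : [set i] i by []; rewrite ij.
  apply: sub_infinite_set => _ [i _ <-]; have [Fh hX' _] := hP [set i].
  by split=> //; apply: hX'; rewrite inE.
exists F; split=> [|s s0 sF||]; 
  [|by apply: fullB; split=> // X /sF/hitsFB|exact: hitsBF|exact: hitsBF].
split=> [|_ [s [r [os ->]]]|_ _ [s [r [os ->]]] [s' [r' [os' ->]]] ne].
- by apply: sub_infinite_set (hitsBF _ hX0) => x [].
- exact: F_inf.
- by apply: a_ad => // e; apply: ne; rewrite e.
Qed.

(** * Psi-spaces *)

Lemma Psi_openP (F : set (set nat)) (U : set (Psi F)) : open U <->
  forall a : F, U (Psi_pt a) -> finite_set (val a `\` Psi_nat F @^-1` U).
Proof.
split=> [[D DB <-] a [V DV Va]|H].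
  have [[n eV]|[b [E [finE eV]]]] := DB _ DV; first by move: Va; rewrite /= eV.
  have ab : a = b by move: Va; rewrite /= eV => -[[]|[? _]].
  apply: sub_finite_set finE => n [an nV]; apply: contrapT => nE; apply: nV.
  by exists V => //; rewrite /= eV -ab; right; exists n.
exists [set V | Psi_base V /\ V `<=` U]; first by move=> V [].
apply/seteqP; split=> [x [V [_ VU] Vx]|[n Un|a Ua]]; first exact: VU.
  by exists [set Psi_nat F n] => //; split=> [|_ ->//]; left; exists n.
exists (Psi_basic a (val a `\` Psi_nat F @^-1` U)); last by left.
split; first by right; exists a, (val a `\` Psi_nat F @^-1` U); split=> //; exact: H.
move=> _ [->//|[n [an nn] <-]]; apply: contrapT => nU; exact: nn.
Qed.

Lemma Psi_closedP (F : set (set nat)) (C : set (Psi F)) : closed C <->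
  forall a : F, infinite_set (val a `&` Psi_nat F @^-1` C) -> C (Psi_pt a).
Proof.
rewrite -openC Psi_openP; split=> H a.
  by move=> inf; apply: contrapT => /H; rewrite preimage_setC setDE setCK.
by move=> nC; rewrite preimage_setC setDE setCK; apply: contrapT => /H.
Qed.

Section AlmostDisjointPsi.
Variable F : set (set nat).
Hypothesis adF : almost_disjoint_family F.
Implicit Types (a b : F) (C D R : set (Psi F)).

Let F_infinite a : infinite_set (val a).
Proof. by have [_ H _] := adF; apply: H; exact: set_valP. Qed.

Let F_ad a b : a <> b -> finite_set (val a `&` val b).
Proof.
move=> ab; have [_ _ H] := adF; apply: H; [exact: set_valP|exact: set_valP|].
by move=> /val_inj.
Qed.

Lemma Psi_regular : regular_space (Psi F).
Proof.
move=> x V Vx; have [O [oO Ox] OV] : exists2 O, open_nbhs x O & O `<=` V.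
  by rewrite nbhsE in Vx.
suff [W [oW cW Wx WO]] : exists W, [/\ open W, closed W, W x & W `<=` O].
  exists W; first by apply: open_nbhs_nbhs.
  by rewrite -((closure_id _).1 cW); exact: subset_trans OV.
case: x {Vx} Ox => [n|a] Ox.
  exists [set Psi_nat F n]; split=> //; [exact/Psi_openP| |by move=> _ ->].
  apply/Psi_closedP => a; case.
  apply: (sub_finite_set _ (finite_set1 n)) => m [_ /=].
  by case.
exists ([set Psi_pt a] `|` Psi_nat F @` (val a `&` Psi_nat F @^-1` O)).
split; last 2 first.
- by left.
- by move=> _ [->|[n [_ On] <-]].
- apply/Psi_openP => b [[->]|[? _ //]].
  apply: sub_finite_set ((Psi_openP O).1 oO a Ox) => n [an nW]; split=> //.
  by move=> On; apply: nW; right; exists n.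
- apply/Psi_closedP => b infb; left; congr Psi_pt; apply: contrapT => /F_ad fin.
  apply: infb; apply: sub_finite_set fin => n [bn [//|[m [am _] [mn]]]].
  by split=> //; rewrite -mn.
Qed.

(** With a finite trace, [a] would have a neighbourhood whose natural numbers avoid the closure of
    the interior. It could meet the interior only in [a], but then the open interior would contain
    almost all of the infinite set [a]. *)
Lemma regclosed_trace R a : regclosed R -> R (Psi_pt a) ->
  infinite_set (val a `&` Psi_nat F @^-1` R).
Proof.
move=> <- clRa fin; set I := interior R in clRa fin.
pose N := [set Psi_pt a] `|` Psi_nat F @` (val a `\` Psi_nat F @^-1` closure I).
have oN : open N.
  apply/Psi_openP => b [[->]|[? _ //]]; apply: sub_finite_set fin => n [an nN].
  split=> //; apply: contrapT => nI; apply: nN; right.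
  by exists n.
have [|x [Ix [xa|[n [_ nI] xn]]]] := clRa N.
  by apply: open_nbhs_nbhs; split=> //; left.
  rewrite {}xa in Ix; have oI : open I by exact: open_interior.
  apply: (@F_infinite a); apply: (finite_subU fin ((Psi_openP I).1 oI a Ix)) => n an.
  have [In|nIn] := pselect (I (Psi_nat F n)); last by right.
  by left; split=> //; exact: subset_closure.
by apply: nI; rewrite /= xn; exact: subset_closure.
Qed.

(** Adding to [C] the numbers outside [D] that belong to its finitely many points of [F] gives a
    clopen set: any other point of [F] meets those in a finite set. *)
Lemma finite_separated C D : closed C -> closed D -> C `&` D = set0 ->
  finite_set [set a | C (Psi_pt a)] -> open_separated C D.
Proof.
move=> cC cD CD0 finC.
have CD x : C x -> ~ D x by move=> Cx Dx; have : (C `&` D) x by []; rewrite CD0.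
pose U := C `|` [set Psi_nat F n | n in
  [set n | (exists2 a, C (Psi_pt a) & val a n) /\ ~ D (Psi_nat F n)]].
have UPt a : U (Psi_pt a) -> C (Psi_pt a) by case=> // -[].
exists U, (~` U); split.
- apply/Psi_openP => a /UPt Ca.
  apply: contrapT => inf; apply: (CD _ Ca); apply: (Psi_closedP D).1 => //.
  apply: sub_infinite_set inf => n [an nU]; split=> //; apply: contrapT => nD.
  by apply: nU; right; exists n => //; split=> //; exists a.
- apply/Psi_openP => a nUa; rewrite -preimage_setC setDE setCK.
  have nCa : ~ C (Psi_pt a) by move=> Ca; apply: nUa; left.
  have fin1 : finite_set (val a `&` Psi_nat F @^-1` C).
    by apply: contrapT => /((Psi_closedP C).1 cC).
  have fin2 : finite_set (\bigcup_(b in [set b | C (Psi_pt b)]) (val a `&` val b)).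
    by apply: bigcup_finite => // b Cb; apply: F_ad => ab; rewrite ab in nCa.
  apply: (finite_subU fin1 fin2) => n [an [Cn|[m [[b Cb bm] _] [mn]]]]; first by left.
  by right; exists b => //; rewrite -mn in an *.
- by move=> x Cx; left.
- by move=> x Dx [Cx|[n [_ nD] nx]]; [exact: CD Dx|rewrite nx in nD].
- exact: setICr.
Qed.

Lemma open_separated_sym C D : open_separated C D -> open_separated D C.
Proof. by move=> [U [V [oU oV CU DV UV]]]; exists V, U; rewrite setIC. Qed.

Lemma pi_closed_closed C : pi_closed C -> closed C.
Proof.
move=> [S [_ SR ->]]; apply: closed_bigI => R /SR <-; exact: closed_closure.
Qed.

(** The list consists of the traces on [nat] of the regular closed sets defining [C]. *)
Lemma pi_closed_hits C : pi_closed C -> infinite_set [set a | C (Psi_pt a)] ->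
  exists s : seq (set nat), (forall X, X \in s -> infinite_set (hits F X)) /\
    forall a, (forall X, X \in s -> infinite_set (val a `&` X)) -> C (Psi_pt a).
Proof.
move=> [_ [/finite_seqP[s ->] SR ->]] inf.
exists [seq Psi_nat F @^-1` R | R <- s]; split=> [_ /mapP[R Rs ->]|a H R /= Rs].
  have : infinite_set (set_val @` [set a | (\bigcap_(R in [set` s]) R) (Psi_pt a)]).
    by rewrite (eq_finite_set (inj_card_eq _))// => ? ? _ _; exact: val_inj.
  apply: sub_infinite_set => _ [a Ca <-]; split; first exact: set_valP.
  by apply: regclosed_trace; [exact: SR|exact: Ca].
apply: (Psi_closedP R).1; first by rewrite -(SR R Rs); exact: closed_closure.
by apply: H; apply/mapP; exists R.
Qed.

Lemma hits_setT : infinite_set (hits F setT).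
Proof.
have [infF Finf _] := adF; apply: sub_infinite_set infF => a Fa; split=> //.
by rewrite setIT; exact: Finf.
Qed.

Lemma Psi_quasi_normal : multiply_full F -> quasi_normal (Psi F).
Proof.
move=> full; split=> [|C D pC pD CD0]; first exact: Psi_regular.
have cC := pi_closed_closed pC; have cD := pi_closed_closed pD.
case: (pselect (finite_set [set a | C (Psi_pt a)])) => [finC|infC].
  exact: finite_separated.
case: (pselect (finite_set [set a | D (Psi_pt a)])) => [finD|infD].
  by apply: open_separated_sym; apply: finite_separated => //; rewrite setIC.
have [s [sF sC]] := pi_closed_hits pC infC.
have [t [tF tD]] := pi_closed_hits pD infD.
(* [setT] keeps the list nonempty when both [C] and [D] are empty intersections. *)
have [X|g _ /(_ set0)[Fg gst _]] := full (setT :: s ++ t) isT.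
  rewrite inE mem_cat => /or3P[/eqP->|/sF//|/tF//]; exact: hits_setT.
pose a : F := SigSub (mem_set Fg).
have : (C `&` D) (Psi_pt a).
  by split; [apply: sC|apply: tD] => X Xs; apply: gst; rewrite inE mem_cat Xs !orbT.
by rewrite CD0.
Qed.

Lemma ad_restrictE X : ad_restrict F X = hits F X.
Proof.
apply/seteqP; split=> a [Fa aX]; split=> //.
  by rewrite (eq_finite_set aX); exact: infinite_nat.
by apply: eq_card_nat => //; exact: countableP.
Qed.

Lemma multiply_full_true_cardinality : multiply_full F -> true_cardinality_c F.
Proof.
move=> full X; rewrite ad_restrictE.
case: (pselect (finite_set (hits F X))) => [fin|inf]; [by left|right].
have [|g gI gP] := full [:: X] isT; first by move=> Y; rewrite inE => /eqP->.
rewrite card_eq_le card_leT /=; apply/pcard_leP/injfunPex; exists g.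
  by move=> r _; have [Fg gX _] := gP r; split=> //; apply: gX; rewrite inE.
by move=> r r' _ _; exact: gI.
Qed.

Lemma Psi_not_almost_normal X : multiply_full F ->
  infinite_set (hits F X) -> infinite_set (hits F (~` X)) ->
  ~ almost_normal (Psi F).
Proof.
move=> full hX hXc [_ norm].
pose C : set (Psi F) := [set x | exists2 a, x = Psi_pt a & finite_set (val a `&` X)].
have oX : open (Psi_nat F @` X) by apply/Psi_openP => a [].
pose E := closure (Psi_nat F @` X).
have traceE a : infinite_set (val a `&` X) -> E (Psi_pt a).
  move=> inf; apply: (Psi_closedP E).1; first exact: closed_closure.
  apply: sub_infinite_set inf => n [an Xn]; split=> //.
  by apply: subset_closure; exists n.
have [|||U [V [oU oV CU EV UV]]] := norm C E.
- apply/Psi_closedP => a; case; apply: (sub_finite_set _ (@finite_set0 nat)).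
  by move=> n [_ [b]].
- exact: closure_open_regclosed.
- apply/seteqP; split=> // _ [[a -> fin] Ea].
  pose N : set (Psi F) := Psi_basic a (val a `&` X).
  have oN : open N.
    apply/Psi_openP => b [[->]|[? _ //]]; apply: sub_finite_set fin => n [an nN].
    split=> //; apply: contrapT => nX; apply: nN; right.
    by exists n => //; split=> // -[].
  have [|_ [[n Xn <-] [//|[m [am nXm] [mn]]]]] := Ea N.
    by apply: open_nbhs_nbhs; split=> //; left.
  by apply: nXm; split=> //; rewrite mn.
have UVn n : U (Psi_nat F n) -> V (Psi_nat F n) -> False.
  by move=> Un Vn; have : (U `&` V) (Psi_nat F n) by []; rewrite UV.
pose W := Psi_nat F @^-1` U.
(* If [W] outside [X] meets infinitely many members of [F], some [a] meets both it and [X]. Then [a]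
   is in [E], so [V] contains almost all of [a] and cannot be disjoint from [U]. *)
have [finW|infW] := pselect (finite_set (hits F (~` X `&` W))); last first.
  have [|g _ /(_ set0)[Fg gX _]] := full [:: X; ~` X `&` W] isT.
    by move=> Y; rewrite !inE => /orP[] /eqP->.
  pose a : F := SigSub (mem_set Fg).
  have infaX : infinite_set (val a `&` X) by apply: gX; rewrite inE eqxx.
  have infaW : infinite_set (val a `&` (~` X `&` W)) by apply: gX; rewrite !inE eqxx orbT.
  apply: infaW; apply: sub_finite_set ((Psi_openP V).1 oV a (EV _ (traceE _ infaX))).
  by move=> n [an [_ Un]]; split=> // /(UVn _ Un).
(* Otherwise the rest of the complement of [X] contains a member of [F]; it is a point of [C], yet
   [U] contains none of its numbers. *)
have infXW : infinite_set (hits F (~` X `\` W)).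
  move=> fin; apply: hXc; apply: (finite_subU finW fin) => a [Fa inf].
  have [fin1|inf1] := pselect (finite_set (a `&` (~` X `&` W))); last by left.
  right; split=> // fin2; apply: inf; apply: (finite_subU fin1 fin2) => n [an nX].
  by have [Wn|nW] := pselect (W n); [left|right].
have [|g _ /(_ set0)[Fg gX gsub]] := full [:: ~` X `\` W] isT.
  by move=> Y; rewrite inE => /eqP->.
pose a : F := SigSub (mem_set Fg).
have asub n : val a n -> (~` X `\` W) n.
  by move=> /gsub[Y /=]; rewrite inE => /eqP->.
have Ca : C (Psi_pt a).
  exists a => //; apply: (sub_finite_set _ (@finite_set0 nat)) => n [an Xn].
  by have [/(_ Xn)] := asub n an.
apply: (@F_infinite a); apply: sub_finite_set ((Psi_openP U).1 oU a (CU _ Ca)).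
by move=> n an; split=> //; case: (asub n an).
Qed.

End AlmostDisjointPsi.

Theorem mainTheorem1 :
  exists F : set (set nat),
    [/\ almost_disjoint_family F,
        true_cardinality_c F,
        quasi_normal (Psi F) &
        ~ almost_normal (Psi F)].
Proof.
have [B Bfull [X [hX hXc]]] := exists_completely_separable.
have [F [adF full FX FXc]] := exists_multiply_full Bfull hX hXc.
exists F; split=> //.
- exact: multiply_full_true_cardinality.
- exact: Psi_quasi_normal.
- exact: Psi_not_almost_normal FXc.
Qed.
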